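(* For any $o$-symmetric $d$-dimensional convex body $K$, $$I(K)\le\mathrm{ill}(K)\le 2C(K)\le 2\,\mathrm{coin}(K),$$ and in general, for any $d$-dimensional convex body $K$, $$I(K)\le C(K)\le\mathrm{coin}(K).$$
   Context: A $d$-dimensional convex body is a compact convex subset of Euclidean space $\mathbb{E}^d$ (origin $o$) with nonempty interior; it is $o$-symmetric if $K=-K$. Illumination: a point $p\in\mathbb{E}^d\setminus K$ illuminates a boundary point $q$ of $K$ if the ray emanating from $p$ and passing through $q$ intersects the interior of $K$ at a point not between $p$ and $q$. A set of points $\{p_i\}$ illuminates $K$ if every boundary point of $K$ is illuminated by some $p_i$. The illumination number $I(K)$ is the smallest $n$ for which $K$ can be illuminated by $n$ points. (It is a known fact that $I(K)$ equals the smallest number of homothets $\lambda_iK+t_i$, $0<\lambda_i<1$, that can cover $K$.) For $o$-symmetric $K$, $\|x\|_K=\inf\{\lambda>0:x\in\lambda K\}$ and the illumination parameter is $$\mathrm{ill}(K)=\inf\Big\{\sum_i\|p_i\|_K:\{p_i\}\text{ illuminates }K,\ p_i\in\mathbb{E}^d\Big\}.$$ The covering parameter of a $d$-dimensional convex body $K$ is $$C(K)=\inf\Big\{\sum_i(1-\lambda_i)^{-1}:K\subseteq\bigcup_i(\lambda_iK+t_i),\ 0<\lambda_i<1,\ t_i\in\mathbb{E}^d\Big\}.$$ With $\gamma_m(K)=\inf\{\lambda>0:K\subseteq\bigcup_{i=1}^m(\lambda K+t_i),\ t_i\in\mathbb{E}^d\}$ for $m\in\mathbb{N}=\{1,2,\dots\}$,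 the covering index is $$\mathrm{coin}(K)=\inf\left\{\frac{m}{1-\gamma_m(K)}:\gamma_m(K)\le\tfrac12,\ m\in\mathbb{N}\right\}.$$ *)

(* Defs.v *)
From HB Require Import structures.
From mathcomp Require Import all_boot all_order all_algebra.
From mathcomp Require Import all_classical all_reals all_analysis.

Set Implicit Arguments.
Unset Strict Implicit.
Unset Printing Implicit Defensive.

Import Order.TTheory GRing.Theory Num.Theory.
Import numFieldNormedType.Exports.

Local Open Scope classical_set_scope.
Local Open Scope ring_scope.

(* Euclidean space E^d is 'rV[R]_d.  Its topology in the library comes from the
   sup norm and is the Euclidean topology; nothing below depends on the metric
   beyond that. *)

Section ConvexBodies.
Context {R : realType} {d : nat}.
Implicit Types (K : set 'rV[R]_d) (p q x t : 'rV[R]_d).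

Definition convex_body K := [/\ compact K, convex_set K & K° !=set0].

Definition o_symmetric K := K = [set - x | x in K].

Definition boundary K : set 'rV[R]_d := closure K `\` K°.

Definition ray p q : set 'rV[R]_d :=
  [set p + s *: (q - p) | s in [set s : R | 0 <= s]].

Definition segment p q : set 'rV[R]_d :=
  [set p + s *: (q - p) | s in [set s : R | 0 <= s <= 1]].

Definition illuminates_point K p q :=
  ~ K p /\ exists x, [/\ ray p q x, K° x & ~ segment p q x].

Definition illuminates K n (p : 'I_n -> 'rV[R]_d) :=
  forall q, boundary K q -> exists i, illuminates_point K (p i) q.

(* Infima are taken in \bar R, where the infimum of the empty set is +oo.  A
   nonempty set of natural numbers attains its infimum, so this is the smallest
   number of points illuminating K. *)
Definition illumination_number K : \bar R :=
  ereal_inf [set n%:R%:E | n in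
    [set n : nat | exists p : 'I_n -> 'rV[R]_d, illuminates K p]].

Definition body_norm K x : R :=
  inf [set l : R | 0 < l /\ [set l *: y | y in K] x].

(* Finite families suffice here and in [covering_parameter]: all summands are
   at least 1 (for the norms, once points lying in K, which illuminate nothing,
   are dropped), so an infinite family has infinite sum. *)
Definition illumination_parameter K : \bar R :=
  ereal_inf [set s | exists n (p : 'I_n -> 'rV[R]_d),
    illuminates K p /\ s = (\sum_i body_norm K (p i))%:E].

Definition homothet K (l : R) t : set 'rV[R]_d := [set l *: x + t | x in K].

Definition covering_parameter K : \bar R :=
  ereal_inf [set s | exists n (l : 'I_n -> R) (t : 'I_n -> 'rV[R]_d),
    [/\ forall i, 0 < l i < 1,
        K `<=` \bigcup_i homothet K (l i) (t i)
      & s = (\sum_i (1 - l i)^-1)%:E]].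

(* For m > 0 the set is nonempty (it contains 1), so the real infimum is
   meaningful; m = 0 is excluded in [covering_index]. *)
Definition gamma K (m : nat) : R :=
  inf [set l : R | 0 < l /\
    exists t : 'I_m -> 'rV[R]_d, K `<=` \bigcup_i homothet K l (t i)].

Definition covering_index K : \bar R :=
  ereal_inf [set (m%:R / (1 - gamma K m))%:E | m in
    [set m : nat | (0 < m)%N /\ gamma K m <= 1 / 2]].

End ConvexBodies.

(* Main.v *)
Require Import Defs.
From mathcomp Require Import all_boot all_order all_algebra.
From mathcomp Require Import all_classical all_reals all_analysis.
From mathcomp Require Import ring lra.

(** The whole chain rests on one geometric remark.  Let [z] be interior to [K],
    let [lK + t] be a homothet with [0 < l < 1], and put [w = t - (1 - l)z], so
    that [lK + t = z + l(K - z) + w].  Moving a point [q] of the homothet by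
    [- w] sends it into [z + l(K - z)], hence into the interior of [K]: the
    direction [- w] illuminates at once all the boundary points of [K] that lie
    in the homothet.  A light source realizing this direction need not be at
    infinity: by [homothet_illuminated], [z + mu w] does as soon as
    [mu > 1 / (1 - l)].

    - A covering by [n] homothets therefore gives [n] illuminating points, and
      each term [1 / (1 - l)] is at least [1]: so [I(K) <= C(K)].
    - If [K] is symmetric, take [z = 0], [w = t].  A homothet that meets [K] has
      [t] in [K - lK = (1 + l)K], so with [mu = 2 / ((1 - l)(1 + l))], which
      exceeds [1 / (1 - l)], the source [mu t] lies in [(2 / (1 - l))K]: so
      [ill(K) <= 2 C(K)] ([homothet_illuminator]).
    - If [K] is symmetric, a source outside [K] has norm at least [1] and a
      source inside [K] illuminates nothing: so [I(K) <= ill(K)].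
    - A covering by [m] homothets of equal ratio [l] contributes [m / (1 - l)]
      to [C(K)], and [l] can be taken arbitrarily close to [gamma_m(K)]: so
      [C(K) <= coin(K)]. *)

Set Implicit Arguments.
Unset Strict Implicit.
Unset Printing Implicit Defensive.

Import Order.TTheory GRing.Theory Num.Theory.
Import numFieldNormedType.Exports.

Local Open Scope classical_set_scope.
Local Open Scope ring_scope.

Section Illumination.
Context {R : realType} {d : nat}.
Implicit Types (K : set 'rV[R]_d) (p q x y z k t : 'rV[R]_d).

Lemma convex_comb K x y (s : R) : convex_set K -> K x -> K y ->
  0 <= s <= 1 -> K (s *: x + (1 - s) *: y).
Proof.
move=> cK Kx Ky /andP[s0 s1].
have := cK x y (Itv01 s0 s1).
by rewrite !in_setE => /(_ Kx Ky).
Qed.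

(** The homothety of center [k] and ratio [a] is a homeomorphism mapping [K] into
    itself, so it maps a neighborhood of [z] in [K] to a neighborhood of the
    combination in [K]. *)
Lemma interior_convex_comb K z k (a : R) : convex_set K -> K° z -> K k ->
  0 < a <= 1 -> K° (a *: z + (1 - a) *: k).
Proof.
move=> cK Kz Kk /andP[a0 a1]; have an0 : a != 0 by rewrite gt_eqF.
rewrite /interior /=.
pose g x := a^-1 *: (x - (1 - a) *: k).
have gz : g (a *: z + (1 - a) *: k) = z.
  by rewrite /g addrK scalerA mulVf ?scale1r.
have cg : continuous g.
  move=> y; apply: (@continuous_comp _ _ _ (fun x => x - (1 - a) *: k)).
    exact: (@cvgB _ 'rV[R]_d _ (nbhs y) _ id (cst _) _ _ cvg_id (cvg_cst _)).
  exact: scaler_continuous.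
have : nbhs (a *: z + (1 - a) *: k) (g @^-1` K).
  by apply: (cg _ K); rewrite gz.
apply: filterS => x /= Kgx.
suff -> : x = a *: g x + (1 - a) *: k.
  by apply: convex_comb => //; rewrite a1 ltW.
by rewrite /g scalerA mulfV // scale1r subrK.
Qed.

Lemma boundary_sub K q : compact K -> boundary K q -> K q.
Proof. by move=> /(compact_closed (@norm_hausdorff _ _)) cK [/cK]. Qed.

(** If the source [p] were in [K], then [q] would be a convex combination of [p]
    and of the interior point beyond it, hence interior: this is why the
    condition [~ K p] comes for free. *)
Lemma illuminates_beyond K p q (e : R) : convex_set K -> boundary K q ->
  0 < e -> K° (q + e *: (q - p)) -> illuminates_point K p q.
Proof.
move=> cK [_ nq] e0 Kx.
have e1 : 1 + e != 0 by rewrite gt_eqF // addr_gt0.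
split.
  move=> Kp; apply: nq.
  have -> : q = (1 + e)^-1 *: (q + e *: (q - p)) + (1 - (1 + e)^-1) *: p.
    by apply/rowP => i; rewrite !mxE; field.
  apply: interior_convex_comb => //.
  by rewrite invr_gt0 addr_gt0 //= invf_le1 ?addr_gt0 // lerDl ltW.
exists (q + e *: (q - p)); split => //.
  exists (1 + e) => /=; first by rewrite addr_ge0 // ltW.
  by apply/rowP => i; rewrite !mxE; ring.
case=> s /= /andP[s0 s1] E; apply: nq; move: Kx.
suff -> : q = p by rewrite subrr scaler0 addr0.
apply/eqP; rewrite -subr_eq0; apply/eqP.
have : (1 + e - s) *: (q - p) = 0.
  by move/rowP: E => E; apply/rowP => i; have := E i; rewrite !mxE => Ei; lra.
by move/eqP; rewrite scaler_eq0 => /orP[/eqP ?|/eqP //]; exfalso; lra.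
Qed.

(** Going from the source [z + mu w] through [q = z + l(k - z) + w] and beyond it
    by the factor [1 / (mu - 1)] cancels [w]: one arrives at
    [z + b(k - z)] with [b = l mu / (mu - 1)], and [b < 1] is exactly the
    condition on [mu]. *)
Lemma homothet_illuminated K z (l mu : R) t q : convex_set K -> K° z ->
  0 < l < 1 -> (1 - l)^-1 < mu -> boundary K q -> homothet K l t q ->
  illuminates_point K (z + mu *: (t - (1 - l) *: z)) q.
Proof.
move=> cK Kz /andP[l0 l1] hmu bq [k Kk kq].
have l'0 : 0 < 1 - l by rewrite subr_gt0.
have hmu' : 1 < mu * (1 - l) by rewrite -ltr_pdivrMr // div1r.
have mu1 : 0 < mu - 1 by nra.
apply: (@illuminates_beyond _ _ _ (mu - 1)^-1); rewrite ?invr_gt0 //.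
have -> : q + (mu - 1)^-1 *: (q - (z + mu *: (t - (1 - l) *: z)))
        = (1 - l * mu / (mu - 1)) *: z + (1 - (1 - l * mu / (mu - 1))) *: k.
  have mun : mu - 1 != 0 by rewrite gt_eqF.
  by rewrite -kq; apply/rowP => i; rewrite !mxE; field.
apply: interior_convex_comb => //; rewrite subr_gt0 ltr_pdivrMr // mul1r.
apply/andP; split; first by nra.
by rewrite lerBlDr lerDl divr_ge0 ?mulr_ge0 //; nra.
Qed.

Lemma body_norm_ge0 K x : 0 <= body_norm K x.
Proof.
rewrite /body_norm; set A := [set _ | _].
have [->|/set0P A0] := eqVneq A set0; first by rewrite inf0.
by apply: lb_le_inf => // ? [/ltW].
Qed.

Lemma body_norm_le K y (l : R) : 0 < l -> K y -> body_norm K (l *: y) <= l.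
Proof.
move=> l0 Ky; apply: ge_inf; last by split => //; exists y.
by exists 0 => ? [/ltW].
Qed.

(** The set of admissible ratios has to be nonempty for the infimum to be
    meaningful; it is because a neighborhood of [0] absorbs every point. *)
Lemma body_norm_ge1 K x : convex_set K -> K° 0 -> ~ K x -> 1 <= body_norm K x.
Proof.
move=> cK K0 nKx; apply: lb_le_inf.
  have cx : s *: x @[s --> (0 : R)] --> (0 : R) *: x.
    exact: (@cvgZr_tmp _ 'rV[R]_d _ (nbhs (0 : R)) _ id).
  have nK : \forall s \near (0 : R)^'+, K (s *: x).
    by move: (cvg_at_right_filter cx) => /(_ K); rewrite scale0r; exact.
  near (0 : R)^'+ => s.
  have s0 : 0 < s by near: s; exact: nbhs_right_gt.
  exists s^-1; split; first by rewrite invr_gt0.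
  exists (s *: x); first by near: s.
  by rewrite scalerA mulVf ?scale1r // gt_eqF.
move=> l [l0 [y Ky yx]]; rewrite leNgt; apply/negP => l1; apply: nKx.
rewrite -yx -[l *: y]addr0 -(scaler0 _ (1 - l)).
apply: convex_comb => //; first exact: interior_subset.
by rewrite !ltW.
Unshelve. all: by end_near. Qed.

Lemma o_symmetricN K x : o_symmetric K -> K x -> K (- x).
Proof. by move=> sK Kx; rewrite sK; exists x. Qed.

Lemma o_symmetric_interior0 K : convex_set K -> K° !=set0 -> o_symmetric K ->
  K° 0.
Proof.
move=> cK [z Kz] sK.
have -> : 0 = 2^-1 *: z + (1 - 2^-1) *: (- z) :> 'rV[R]_d.
  by apply/rowP => i; rewrite !mxE; field.
apply: interior_convex_comb => //; last by lra.
by apply: o_symmetricN => //; exact: interior_subset.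
Qed.

(** A homothet that does not meet [K] carries no boundary point to illuminate;
    the source [0] then has the least norm. *)
Lemma homothet_illuminator K (l : R) t : compact K -> convex_set K ->
  K° !=set0 -> o_symmetric K -> 0 < l < 1 ->
  exists p, (forall q, boundary K q -> homothet K l t q ->
               illuminates_point K p q) /\
            body_norm K p <= 2 * (1 - l)^-1.
Proof.
move=> kK cK iK sK l01; have /andP[l0 l1] := l01.
have K0 := o_symmetric_interior0 cK iK sK.
have c0 : 0 < 2 * (1 - l)^-1 by rewrite mulr_gt0 // invr_gt0 subr_gt0.
have [[q0 [Kq0 [k Kk kq0]]]|disj] := pselect (exists q, K q /\ homothet K l t q);
    last first.
  exists 0; split.
    by move=> q bq hq; case: disj; exists q; split => //; exact: boundary_sub.
  rewrite -(scaler0 _ (2 * (1 - l)^-1)); apply: body_norm_le => //.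
  exact: interior_subset.
have ln : 1 - l != 0 by rewrite subr_eq0 gt_eqF.
have lp : 1 + l != 0 by rewrite gt_eqF // addr_gt0.
exists (0 + (2 / ((1 - l) * (1 + l))) *: (t - (1 - l) *: 0)); split.
  move=> q bq hq; apply: homothet_illuminated => //.
  rewrite invfM mulrA [2 * _]mulrC -mulrA ltr_pMr ?invr_gt0 ?subr_gt0 //.
  by rewrite ltr_pdivlMr ?addr_gt0 // mul1r; lra.
pose y := (1 + l)^-1 *: q0 + (1 - (1 + l)^-1) *: (- k).
have -> : 0 + (2 / ((1 - l) * (1 + l))) *: (t - (1 - l) *: 0)
        = (2 * (1 - l)^-1) *: y.
  by rewrite /y -kq0; apply/rowP => i; rewrite !mxE; field; rewrite lp ln.
apply: body_norm_le => //; apply: convex_comb => //; first exact: o_symmetricN.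
by rewrite invr_ge0 invf_le1 ?addr_gt0 ?addr_ge0 // ?lerDl ltW.
Qed.

(** Sources in [K] illuminate nothing, so only the others have to be counted. *)
Lemma illumination_number_le_card K n (p : 'I_n -> 'rV[R]_d) (A : {set 'I_n}) :
  illuminates K p -> (forall i, ~ K (p i) -> i \in A) ->
  (illumination_number K <= (#|A|%:R)%:E)%E.
Proof.
move=> ip hA; apply: ereal_inf_lbound; exists #|A| => //=.
exists (fun j => p (enum_val j)) => q /ip [i ipi].
have iA : i \in A by apply: hA; case: ipi.
by exists (enum_rank_in iA i); rewrite enum_rankK_in.
Qed.

Lemma illumination_number_le_parameter K : convex_set K -> K° 0 ->
  (illumination_number K <= illumination_parameter K)%E.
Proof.
move=> cK K0; apply/ereal_infP => _ [n [p [ip ->]]].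
pose A := [set i | ~~ `[< K (p i) >]]%SET.
apply: (@le_trans _ _ (#|A|%:R)%:E).
  by apply: illumination_number_le_card ip _ => i nK; rewrite inE; apply/asboolPn.
rewrite lee_fin -sum1_card natr_sum big_mkcond; apply: ler_sum => i _.
rewrite inE; case: asboolPn => [nK|_]; last exact: body_norm_ge0.
exact: body_norm_ge1.
Qed.

Lemma illumination_parameter_le_covering K : convex_body K -> o_symmetric K ->
  (illumination_parameter K <= 2%:E * covering_parameter K)%E.
Proof.
move=> [kK cK iK] sK; rewrite -lee_pdivrMl //.
apply/ereal_infP => _ [n [l [t [l01 cov ->]]]]; rewrite lee_pdivrMl // -EFinM.
have /choice [p pP] i := homothet_illuminator (t i) kK cK iK sK (l01 i).
apply: (@le_trans _ _ (\sum_i body_norm K (p i))%:E).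
  apply: ereal_inf_lbound; exists n, p; split => // q bq.
  have [i _ qi] := cov q (boundary_sub kK bq).
  by exists i; have [+ _] := pP i; apply.
by rewrite lee_fin mulr_sumr; apply: ler_sum => i _; have [] := pP i.
Qed.

Lemma illumination_number_le_covering K : convex_body K ->
  (illumination_number K <= covering_parameter K)%E.
Proof.
move=> [kK cK [z Kz]]; apply/ereal_infP => _ [n [l [t [l01 cov ->]]]].
(* any [mu] larger than [1 / (1 - l)] would do *)
pose p i := z + ((1 - l i)^-1 + 1) *: (t i - (1 - l i) *: z).
apply: (@le_trans _ _ (#|[set: 'I_n]%SET|%:R)%:E).
  apply: (@illumination_number_le_card _ _ p) => [q bq|i _]; last by rewrite inE.
  have [i _ qi] := cov q (boundary_sub kK bq).
  by exists i; apply: homothet_illuminated => //; rewrite ltrDl.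
rewrite lee_fin cardsT -sum1_card natr_sum; apply: ler_sum => i _.
have /andP[l0 l1] := l01 i.
by rewrite -div1r ler_pdivlMr ?subr_gt0 // mul1r lerBlDr lerDl ltW.
Qed.

(** The value [m / (1 - gamma K m)] is approached by reals [r] above it: each [r]
    allows all the ratios up to [1 - m / r], which exceeds [gamma K m], hence a
    ratio for which a covering exists, be the infimum [gamma K m] attained or
    not. *)
Lemma covering_parameter_le_index K :
  (covering_parameter K <= covering_index K)%E.
Proof.
apply/ereal_infP => _ [m [m0 gm] <-].
have g1 : 0 < 1 - gamma K m by lra.
have mR : 0 < m%:R :> R by rewrite ltr0n.
apply/lee_addgt0Pr => e e0; rewrite -EFinD.
set r := _ + e.
have r0 : 0 < r by rewrite addr_gt0 // divr_gt0.
have gr : gamma K m < 1 - m%:R / r.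
  rewrite ltrBrDl addrC -ltrBrDl ltr_pdivrMr // mulrC -ltr_pdivrMr //.
  by rewrite /r ltrDl.
have [|l [l0 [t cov]] lr] := inf_lt _ gr.
  exists 1; split => //; exists (fun=> 0) => x Kx.
  by exists (Ordinal m0) => //; exists x => //; rewrite scale1r addr0.
have lr' : m%:R / r < 1 - l by lra.
have l1 : 0 < 1 - l by apply: lt_trans lr'; rewrite divr_gt0.
apply: (@le_trans _ _ (\sum_(i < m) (1 - l)^-1)%:E).
  apply: ereal_inf_lbound; exists m, (fun=> l), t; split => // i.
  by rewrite l0 -subr_gt0.
rewrite lee_fin sumr_const card_ord -mulr_natl ler_pdivrMr //.
by rewrite mulrC -ler_pdivrMr // ltW.
Qed.

End Illumination.

Theorem proposition2p1 (R : realType) (d : nat) (K : set 'rV[R]_d)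
    (hK : convex_body K) :
  (o_symmetric K ->
     [/\ (illumination_number K <= illumination_parameter K)%E,
         (illumination_parameter K <= 2%:E * covering_parameter K)%E
       & (2%:E * covering_parameter K <= 2%:E * covering_index K)%E]) /\
  ((illumination_number K <= covering_parameter K)%E /\
   (covering_parameter K <= covering_index K)%E).
Proof.
have [_ cK iK] := hK.
split; last first.
  by split; [exact: illumination_number_le_covering
            |exact: covering_parameter_le_index].
move=> sK; split.
- by apply: illumination_number_le_parameter => //; exact: o_symmetric_interior0.
- exact: illumination_parameter_le_covering.
- by rewrite lee_pmul2l ?lte_fin //; exact: covering_parameter_le_index.
Qed.
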